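(* For every $\mu\in cabv(X)$ define $$\|\mu\|_{MK}=\sup\Big\{\Big|\int f\,d\mu\Big| \;:\; f\in BL_1(X)\Big\}.$$ Then the function $\mu\mapsto\|\mu\|_{MK}$ is a norm on $cabv(X)$, and $\|\mu\|_{MK}\le\|\mu\|$ for every $\mu\in cabv(X)$.
   Context: $(T,d)$ is a compact metric space with at least two elements, with Borel $\sigma$-algebra $\mathcal{B}$. $X$ is a nonzero Hilbert space over $K$ ($K=\mathbb{R}$ or $K=\mathbb{C}$), with scalar product $(\cdot\mid\cdot)$ (linear in the first variable, conjugate-linear in the second) and norm $\|\cdot\|$. $C(X)$ is the space of continuous functions $f:T\to X$ with the sup norm $\|f\|=\sup_{t\in T}\|f(t)\|$. $cabv(X)$ is the vector space over $K$ of $\sigma$-additive measures $\mu:\mathcal{B}\to X$ of bounded variation, where the variation is $|\mu|(A)=\sup\sum_i\|\mu(A_i)\|$ over finite partitions $(A_i)$ of $A$ into Borel sets; $\|\mu\|=|\mu|(T)$ is the variational norm. Integral: for a simple function $f=\sum_{i=1}^m\varphi_{A_i}x_i$ ($A_i\in\mathcal{B}$, $x_i\in X$, $\varphi_{A}$ the indicator function of $A$) put $\int f\,d\mu=\sum_{i=1}^m(x_i\mid\mu(A_i))\in K$; for $f\in C(X)$ put $\int f\,d\mu=\lim_n\int f_n\,d\mu$, where $(f_n)$ is any sequence of simple functions converging uniformly to $f$ (the limit exists and does not depend on the sequence; the integral is linear in $f$, conjugate-linear in $\mu$, and $|\int f\,d\mu|\le\|\mu\|\|f\|$). $L(X)$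 is the space of Lipschitz functions $f:T\to X$, $\|f\|_L$ is the least Lipschitz constant of $f$, $\|f\|_{BL}=\|f\|+\|f\|_L$, and $BL_1(X)=\{f\in L(X):\|f\|_{BL}\le1\}$. *)

(* Defs.v *)
From HB Require Import structures.
From mathcomp Require Import all_boot all_order all_algebra.
From mathcomp Require Import all_classical all_reals all_analysis.
From mathcomp Require Import complex.

Set Implicit Arguments.
Unset Strict Implicit.
Unset Printing Implicit Defensive.

Import Order.TTheory GRing.Theory Num.Theory.
Import numFieldNormedType.Exports.

Local Open Scope classical_set_scope.
Local Open Scope ring_scope.

Variant scalar_kind := RealScalars | ComplexScalars.

Definition scalars (R : realType) (k : scalar_kind) : numFieldType :=
  match k with RealScalars => R | ComplexScalars => R[i] end.

Definition conj_scalar (R : realType) (k : scalar_kind) :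
    scalars R k -> scalars R k :=
  match k with
  | RealScalars => fun x => x
  | ComplexScalars => fun z => conjc z
  end.
Arguments conj_scalar {R k}.

Definition re_scalar (R : realType) (k : scalar_kind) : scalars R k -> R :=
  match k with
  | RealScalars => fun x => x
  | ComplexScalars => fun z => complex.Re z
  end.

Section scalars_and_norms.
Variables (R : realType) (k : scalar_kind).
Local Notation K := (scalars R k).

(* The norms of the library take their values in the field of scalars, always
   in its nonnegative reals: [rnorm v] is `|v| seen as an element of R. *)
Definition rnorm (V : normedZmodType K) (v : V) : R := re_scalar `|v|.

(* {dot X for conj_scalar} is the type of the positive definite hermitian forms
   that are linear in the first variable and conjugate-linear in the second. *)
Definition norm_of_dot (X : normedModType K) (dot : {dot X for @conj_scalar R k})
    : Prop :=
  forall x : X, `|x| ^+ 2 = dot x x.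

Definition is_norm (V : lmodType K) (N : V -> R) : Prop :=
  [/\ forall v, 0 <= N v,
      forall v, N v = 0 -> v = 0,
      forall (a : K) v, N (a *: v) = rnorm a * N v
    & forall v w, N (v + w) <= N v + N w].

Lemma re_scalarD (x y : K) : re_scalar (x + y) = re_scalar x + re_scalar y.
Proof. by case: k x y => //= -[a b] [c d]. Qed.

Lemma re_scalar_ge0 (x : K) : 0 <= x -> 0 <= re_scalar x.
Proof. by case: k x => //= -[a b]; rewrite lecE /= => /andP[]. Qed.

Lemma re_scalar_le (x y : K) : x <= y -> re_scalar x <= re_scalar y.
Proof.
by case: k x y => //= -[a b] [c d]; rewrite lecE /= => /andP[].
Qed.

Lemma re_scalarM_ge0 (x y : K) : 0 <= x -> 0 <= y ->
  re_scalar (x * y) = re_scalar x * re_scalar y.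
Proof.
case: k x y => //= -[a b] [c d]; rewrite !lecE /= => /andP[/eqP-> _].
by move=> /andP[/eqP-> _]; rewrite mul0r subr0.
Qed.

Lemma rnorm_ge0 (V : normedZmodType K) (v : V) : 0 <= rnorm v.
Proof. exact/re_scalar_ge0/normr_ge0. Qed.

Lemma rnorm0 (V : normedZmodType K) : rnorm (0 : V) = 0.
Proof. by rewrite /rnorm normr0; case: k. Qed.

Lemma ler_rnormD (V : normedZmodType K) (v w : V) :
  rnorm (v + w) <= rnorm v + rnorm w.
Proof. by rewrite /rnorm -re_scalarD; exact/re_scalar_le/ler_normD. Qed.

Lemma rnormZ (V : normedModType K) (a : K) (v : V) :
  rnorm (a *: v) = rnorm a * rnorm v.
Proof. by rewrite /rnorm normrZ re_scalarM_ge0. Qed.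

End scalars_and_norms.

Definition borel (T : topologicalType) : set (set T) := <<s @open T >>.

Section vector_measures.
Variables (R : realType) (k : scalar_kind).
Variables (T : metricType R) (X : completeNormedModType (scalars R k)).
Implicit Types (mu nu : set T -> X) (A : set T).
Local Notation K := (scalars R k).

Definition borel_sigma_additive mu : Prop :=
  forall F : nat -> set T, (forall i, borel (F i)) -> trivIset setT F ->
    \sum_(0 <= i < n) mu (F i) @[n --> \oo] --> mu (\bigcup_i F i).

Definition variation mu A : \bar R :=
  ereal_sup [set v | exists (n : nat) (P : 'I_n -> set T),
    [/\ forall i, borel (P i), partition setT P A
      & v = (\sum_(i < n) rnorm (mu (P i)))%:E]].

(* A measure on the Borel sets is encoded as a function on all subsets of T
   that vanishes off the Borel sets, so that two measures are equal as soon as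
   they agree on the Borel sets. *)
Definition is_cabv mu : Prop :=
  [/\ forall A, ~ borel A -> mu A = 0,
      borel_sigma_additive mu
    & (variation mu setT < +oo)%E].

Lemma variation0 A : (variation (0%R : set T -> X) A <= 0)%E.
Proof.
apply: ge_ereal_sup => _ [n [P [_ _ ->]]].
by rewrite big1// => i _; rewrite /GRing.zero/= rnorm0.
Qed.

Lemma le_variationZD (a : K) mu nu A :
  (variation (a *: mu + nu)%R A <=
   (rnorm a)%:E * variation mu A + variation nu A)%E.
Proof.
apply: ge_ereal_sup => _ [n [P [bP pP ->]]].
have le1 (m : set T -> X) :
    ((\sum_(i < n) rnorm (m (P i)))%:E <= variation m A)%E.
  by apply: ereal_sup_ubound; exists n, P.
apply: (@le_trans _ _
    ((rnorm a * \sum_(i < n) rnorm (mu (P i)))%:E +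
     (\sum_(i < n) rnorm (nu (P i)))%:E)%E).
  rewrite -EFinD lee_fin mulr_sumr -big_split/=; apply: ler_sum => i _.
  by rewrite -rnormZ; exact: ler_rnormD.
apply: leeD => //; rewrite EFinM; apply: lee_wpmul2l => //.
by rewrite lee_fin rnorm_ge0.
Qed.

Definition cabv_pred : {pred set T -> X} := fun mu => `[< is_cabv mu >].

Lemma cabv_submod_closed : submod_closed cabv_pred.
Proof.
split=> [|a mu nu /asboolP[mu0 mus muv] /asboolP[nu0 nus nuv]]; apply/asboolP.
  split => //.
  - move=> F _ _; rewrite [X in X @ _](_ : _ = cst 0); first exact: cvg_cst.
    by apply/funext => n; rewrite big1.
  - exact: le_lt_trans (variation0 _) _.
split.
- move=> A bA; rewrite -[LHS]/(a *: mu A + nu A).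
  by rewrite mu0// nu0// scaler0 addr0.
- move=> F bF tF; rewrite -[X in _ --> X]/(a *: mu _ + nu _).
  rewrite [X in X @ _](_ : _ = fun n => a *: (\sum_(0 <= i < n) mu (F i)) +
                                        \sum_(0 <= i < n) nu (F i)).
    by apply: cvgD; [apply: cvgZr; exact: mus | exact: nus].
  by apply/funext => n; rewrite scaler_sumr -big_split.
- apply: le_lt_trans (le_variationZD _ _ _ _) _.
  by rewrite lte_add_pinfty// lte_mul_pinfty// lee_fin rnorm_ge0.
Qed.

HB.instance Definition _ :=
  GRing.isSubmodClosed.Build K (set T -> X) cabv_pred cabv_submod_closed.

Record cabv := Cabv {
  cabv_val :> set T -> X ;
  cabv_valP : cabv_val \in cabv_pred }.

HB.instance Definition _ := [isSub for cabv_val].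
HB.instance Definition _ := [Choice of cabv by <:].
HB.instance Definition _ := [SubChoice_isSubLmodule of cabv by <:].

Definition variation_norm (mu : cabv) : R := fine (variation mu setT).

Definition lipschitz_constant (f : T -> X) (c : R) : Prop :=
  0 <= c /\ forall s t, rnorm (f s - f t) <= c * mdist s t.

Definition lipschitz_fun (f : T -> X) : Prop := exists c, lipschitz_constant f c.

Definition sup_norm (f : T -> X) : R := sup [set rnorm (f t) | t in setT].

Definition lipschitz_norm (f : T -> X) : R := inf (lipschitz_constant f).

Definition BL_norm (f : T -> X) : R := sup_norm f + lipschitz_norm f.

Definition BL1 : set (T -> X) := [set f | lipschitz_fun f /\ BL_norm f <= 1].

(* The list of the pairs (A_i, x_i) represents the function
   \sum_i \1_(A_i) *: x_i, which is simple when all the A_i are Borel. *)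
Definition simple_rep := seq (set T * X).

Definition simple_borel (s : simple_rep) : Prop :=
  forall p, p \in s -> borel p.1.

Definition simple_fun (s : simple_rep) (t : T) : X :=
  \sum_(p <- s) (\1_(p.1) t : K) *: p.2.

Variable dot : {dot X for @conj_scalar R k}.

Definition simple_integral (mu : cabv) (s : simple_rep) : K :=
  \sum_(p <- s) dot p.2 (mu p.1).

Definition integral_value (mu : cabv) (f : T -> X) (v : K) : Prop :=
  exists s : nat -> simple_rep,
    [/\ forall n, simple_borel (s n),
        {uniform, (fun n => simple_fun (s n)) @ \oo --> f}
      & simple_integral mu (s n) @[n --> \oo] --> v].

(* For f continuous, such a v exists and is unique: it is the limit along any
   sequence of simple functions that converges uniformly to f. *)
Definition vintegral (mu : cabv) (f : T -> X) : K :=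
  xget 0 (integral_value mu f).

Definition MK_values (mu : cabv) : set R :=
  [set rnorm (vintegral mu f) | f in BL1].

Definition MK_norm (mu : cabv) : R := sup (MK_values mu).

End vector_measures.

(* Main.v *)
Require Import Defs.
From HB Require Import structures.
From mathcomp Require Import all_boot all_order all_algebra.
From mathcomp Require Import all_classical all_reals all_analysis.
From mathcomp Require Import complex lra.

Set Implicit Arguments.
Unset Strict Implicit.
Unset Printing Implicit Defensive.

Import Order.TTheory GRing.Theory Num.Theory.
Import numFieldNormedType.Exports.

Local Open Scope classical_set_scope.
Local Open Scope ring_scope.

(** The two halves of the seminorm estimate, [MK_norm <= variation_norm] and
    the existence of the integral, both come from
    |I(s)| <= sup |s| * |mu|(T) for simple functions [s], seen on a common
    refinement of the sets of [s].

    Definiteness does not go through dominated convergence.  Let [d] be the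
    distance to the complement of an open set U, so that U = {d > 0}, and test
    mu against c * min(1, d / r) *: x.  This function is the uniform limit of
    the averages of the indicators of {d > i r / N} for i < N (layer cake), so
    its integral is an average of the scalars c * (x | mu {d > a}), 0 <= a < r.
    By sigma-additivity mu {d > a} tends to mu {d > 0} as a decreases to 0;
    taking x = mu U gives |mu U|^2 = 0, and mu = 0 by the pi-lambda theorem. *)

(** * Scalars and norms *)

Section scalars.
Variables (R : realType) (k : scalar_kind).
Local Notation K := (scalars R k).

(** The canonical embedding of the reals in K. Through it, inequalities between K-valued norms
    become inequalities in [R], where archimedean and order arguments are available. *)
Definition to_scalar : R -> K :=
  match k with
  | RealScalars => fun x => x
  | ComplexScalars => fun x => (x%:C)%C
  end.

Lemma to_scalarD (x y : R) : to_scalar (x + y) = to_scalar x + to_scalar y.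
Proof. by rewrite /to_scalar; case: k => //=; rewrite rmorphD. Qed.

Lemma to_scalarM (x y : R) : to_scalar (x * y) = to_scalar x * to_scalar y.
Proof. by rewrite /to_scalar; case: k => //=; rewrite rmorphM. Qed.

Lemma to_scalar0 : to_scalar 0 = 0.
Proof. by rewrite /to_scalar; case: k. Qed.

Lemma to_scalar1 : to_scalar 1 = 1.
Proof. by rewrite /to_scalar; case: k. Qed.

Lemma to_scalarN (x : R) : to_scalar (- x) = - to_scalar x.
Proof. by rewrite /to_scalar; case: k => //=; rewrite rmorphN. Qed.

Lemma le_to_scalar (x y : R) : (to_scalar x <= to_scalar y) = (x <= y).
Proof. by rewrite /to_scalar; case: k => //=; rewrite lecR. Qed.

Lemma ltr0_to_scalar (x : R) : (0 < to_scalar x) = (0 < x).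
Proof. by rewrite /to_scalar; case: k => //=; rewrite ltcR. Qed.

Lemma to_scalarK : cancel to_scalar (@re_scalar R k).
Proof. by rewrite /to_scalar; case: k. Qed.

Lemma re_scalarK (x : K) : 0 <= x -> to_scalar (re_scalar x) = x.
Proof.
rewrite /to_scalar; case: k x => //= -[a b].
by rewrite lecE /= => /andP[/eqP-> _].
Qed.

Lemma normr_to_scalar (x : R) : `|to_scalar x| = to_scalar `|x|.
Proof.
have /orP[x0|x0] := le_total 0 x.
  by rewrite !ger0_norm// -to_scalar0 le_to_scalar.
by rewrite !ler0_norm ?to_scalarN// -to_scalar0 le_to_scalar.
Qed.

Lemma rnorm_to_scalar (x : R) : rnorm (to_scalar x) = `|x|.
Proof. by rewrite /rnorm normr_to_scalar to_scalarK. Qed.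

Lemma normr_rnorm (V : normedZmodType K) (v : V) : `|v| = to_scalar (rnorm v).
Proof. by rewrite re_scalarK. Qed.

Lemma rnormN (V : normedZmodType K) (v : V) : rnorm (- v) = rnorm v.
Proof. by rewrite /rnorm normrN. Qed.

Lemma rdistC (V : normedZmodType K) (v w : V) : rnorm (v - w) = rnorm (w - v).
Proof. by rewrite -rnormN opprB. Qed.

Lemma rnorm_eq0 (V : normedZmodType K) (v : V) : rnorm v = 0 -> v = 0.
Proof.
by move=> v0; apply/eqP; rewrite -normr_eq0 normr_rnorm v0 to_scalar0.
Qed.

Lemma ler_rdistD (V : normedZmodType K) (u v w : V) :
  rnorm (v - w) <= rnorm (v - u) + rnorm (u - w).
Proof. by apply: le_trans (ler_rnormD _ _); rewrite addrA subrK. Qed.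

Lemma rnormM (x y : K) : rnorm (x * y) = rnorm x * rnorm y.
Proof. by rewrite /rnorm normrM re_scalarM_ge0. Qed.

Lemma ler_rnorm_sum (V : normedZmodType K) I (r : seq I) (P : pred I)
    (F : I -> V) :
  rnorm (\sum_(i <- r | P i) F i) <= \sum_(i <- r | P i) rnorm (F i).
Proof.
elim/big_rec2: _ => [|i x y _ IH]; first by rewrite rnorm0.
exact: le_trans (ler_rnormD _ _) (lerD _ IH).
Qed.

(** Convergence is tested against positive elements of K. Such an element is [to_scalar] of its
    [re_scalar], even in the complex case, so real errors suffice. *)
Lemma cvg_rdistP (V : normedModType K) (u : nat -> V) (l : V) :
  u n @[n --> \oo] --> l <->
  forall e : R, 0 < e -> \forall n \near \oo, rnorm (l - u n) <= e.
Proof.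
split=> [/cvgrPdist_le ul e e0|ul].
  have e0' : 0 < to_scalar e by rewrite ltr0_to_scalar.
  near=> n.
  rewrite -le_to_scalar -normr_rnorm; near: n; exact: ul.
apply/cvgrPdist_le => e e0.
have e0' : 0 < re_scalar e.
  by rewrite -ltr0_to_scalar re_scalarK// ltW.
near=> n.
rewrite -(re_scalarK (ltW e0)) normr_rnorm le_to_scalar.
near: n; exact: ul.
Unshelve. all: end_near. Qed.

Lemma mul_conj_scalar (x : K) : x * conj_scalar x = `|x| ^+ 2.
Proof.
case: k x => /= x; first by rewrite real_normK ?num_real// expr2.
by rewrite sqr_normc.
Qed.

Lemma rnorm_conj_scalar (x : K) : rnorm (conj_scalar x) = rnorm x.
Proof. by case: k x => //= -[a b]; rewrite /rnorm /= sqrrN. Qed.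

(** The vector [w] is [D] times the component of [x] orthogonal to [y], scaled to avoid a division.
    The bound is 0 <= (w | w) = D (D (x | x) - |(x | y)|^2) after cancelling [D] > 0. *)
Lemma Cauchy_Schwarz (X : normedModType K)
    (dot : {dot X for @conj_scalar R k}) :
  norm_of_dot dot -> forall x y : X, rnorm (dot x y) <= rnorm x * rnorm y.
Proof.
move=> dotE x y; have [->|y0] := eqVneq y 0.
  by rewrite linear0 !rnorm0 mulr0.
have hermE u v : dot u v = conj_scalar (dot v u).
  by rewrite (@hermitian_subproof _ _ _ _ dot) expr0 mul1r.
have dotZr u v a : dot u (a *: v) = conj_scalar a * dot u v.
  by rewrite (@linearr_subproof _ _ _ _ _ _ dot).
set D := dot y y; have D0 : 0 < D by exact: neq0_dnorm_gt0.
pose w := D *: x - dot x y *: y.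
have wy : dot w y = 0.
  by rewrite /w linearBl /= !linearZl /= mulrC subrr.
have ww : dot w w = D * (D * dot x x - dot x y * conj_scalar (dot x y)).
  rewrite {2}/w linearB /= !dotZr wy mulr0 subr0.
  by rewrite -(hermE y y) /w linearBl /= !linearZl /= -(hermE y x).
have ww0 : 0 <= dot w w by rewrite -dotE exprn_ge0.
move: ww0; rewrite ww pmulr_rge0// subr_ge0 mul_conj_scalar /D -!dotE.
rewrite -exprMn ler_pXn2r ?nnegrE ?mulr_ge0// mulrC => xy.
rewrite -re_scalarM_ge0//; exact: re_scalar_le.
Qed.

End scalars.

(** * Measures on Borel sets *)

Section borel_sets.
Variable T : topologicalType.
Implicit Types A B : set T.

Lemma borel0 : borel (@set0 T). Proof. exact: sigma_algebra0. Qed.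

Lemma borelC A : borel A -> borel (~` A).
Proof. by rewrite -setTD; exact: sigma_algebraCD. Qed.

Lemma borelT : borel (@setT T).
Proof. by have := borelC borel0; rewrite setC0. Qed.

Lemma borelI A B : borel A -> borel B -> borel (A `&` B).
Proof.
have subT C : borel C -> C `<=` @setT T by move=> _; exact: subsetT.
have := (sigma_algebraP subT).1 (smallest_sigma_algebra _ _).
by case=> _ _ _ /(_ A B).
Qed.

Lemma borelU A B : borel A -> borel B -> borel (A `|` B).
Proof.
move=> bA bB; rewrite -(setCK (A `|` B)) setCU.
by apply: borelC; apply: borelI; exact: borelC.
Qed.

Lemma borelD A B : borel A -> borel B -> borel (A `\` B).
Proof. by move=> bA bB; rewrite setDE; apply: borelI => //; exact: borelC. Qed.

Lemma open_borel A : open A -> borel A.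
Proof. exact: sub_sigma_algebra. Qed.

End borel_sets.
#[local] Hint Resolve borel0 borelT : core.

(** * Additivity, continuity from below and variation of vector measures *)

Section cabv_theory.
Variables (R : realType) (k : scalar_kind).
Variables (T : metricType R) (X : completeNormedModType (scalars R k)).
Local Notation K := (scalars R k).
Implicit Types (mu : cabv T X) (A B : set T).

Lemma cabv_is_cabv mu : is_cabv mu.
Proof. exact/asboolP/cabv_valP. Qed.

Lemma cabv_sigma_additive mu : borel_sigma_additive mu.
Proof. by case: (cabv_is_cabv mu). Qed.

(** The constant sequence of empty sets is disjoint, so its partial sums converge; two consecutive
    ones differ by [mu set0], which is therefore arbitrarily small. *)
Lemma cabv_set0 mu : mu set0 = 0.
Proof.
have /cvg_rdistP h : \sum_(0 <= i < n) mu set0 @[n --> \oo] --> mu set0.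
  rewrite -[in X in _ --> X](@bigcup0 T nat setT (fun=> set0))//.
  apply: (@cabv_sigma_additive mu (fun=> set0)) => //.
  by apply/trivIsetP => i j _ _ _; rewrite set0I.
apply: rnorm_eq0; apply/eqP; rewrite eq_le rnorm_ge0 andbT.
apply/ler_addgt0Pr => e e0; rewrite add0r.
have [N _ hN] := h _ (divr_gt0 e0 (ltr0n _ 2)).
have := hN N (leqnn N); have := hN N.+1 (leqnSn N).
rewrite /= !big_nat_recr//=.
set S := \sum_(_ <= _ < _) _ => h1 h2.
have -> : mu set0 = (mu set0 - S) - (mu set0 - (S + mu set0)).
  by rewrite opprB addrK subrK.
apply: le_trans (ler_rnormD _ _) _; rewrite rnormN (splitr e).
exact: lerD.
Qed.

Lemma cabv_setU mu A B : borel A -> borel B -> A `&` B = set0 ->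
  mu (A `|` B) = mu A + mu B.
Proof.
move=> bA bB; rewrite trivIset_bigcup2 => AB.
have bF i : borel (bigcup2 A B i) by case: i => [|[]].
have := @cabv_sigma_additive mu _ bF AB; rewrite bigcup2E => h.
apply: (cvg_unique (@norm_hausdorff _ X) h); apply: cvg_near_cst.
exists 2%N => // -[|[|n]]//= _; rewrite 2?big_nat_recl//= big1 ?addr0// => i _.
exact: cabv_set0.
Qed.

Lemma cabv_setD mu A B : borel A -> borel B -> B `<=` A ->
  mu (A `\` B) = mu A - mu B.
Proof.
move=> bA bB BA; rewrite -[in RHS](setDUK BA) cabv_setU//; first 1 last.
- exact: borelD.
- by rewrite setDIK.
by rewrite addrAC subrr add0r.
Qed.

Lemma cabv_nondecreasing_cvg mu (F : nat -> set T) :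
  (forall n, borel (F n)) -> nondecreasing_seq F ->
  mu (F n) @[n --> \oo] --> mu (\bigcup_n F n).
Proof.
move=> bF ndF; rewrite -eq_bigcup_seqD.
have bD n : borel (seqD F n) by case: n => //= n; exact: borelD.
have := @cabv_sigma_additive mu _ bD (trivIset_seqD ndF).
(* The shift makes the sums telescope: the first n + 1 differences add up to [mu (F n)]. *)
rewrite -(cvg_shiftS (fun n => \sum_(0 <= i < n) mu (seqD F i))).
have -> : (fun n => \sum_(0 <= i < n.+1) mu (seqD F i)) = (fun n => mu (F n)).
  apply/funext => n.
  elim: n => [|n IH]; first by rewrite big_nat1.
  rewrite big_nat_recr//= IH cabv_setD//; last exact/subsetPset/ndF.
  by rewrite addrC subrK.
by [].
Qed.

Lemma cabv_partition mu (I : finType) (P : I -> set T) A :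
  borel A -> (forall i, borel (P i)) -> trivIset setT P ->
  \bigcup_i P i = setT -> mu A = \sum_i mu (A `&` P i).
Proof.
move=> bA bP tP PT.
have b r : borel (\big[setU/set0]_(i <- r) P i).
  by elim/big_rec: _ => // i B _; exact: borelU.
(* The list must be free of repetitions: additivity applies only if the new atom is disjoint from
   those already collected. *)
have h (r : seq I) : uniq r ->
    mu (A `&` \big[setU/set0]_(i <- r) P i) = \sum_(i <- r) mu (A `&` P i).
  elim: r => [_|i r IH /= /andP[ir /IH {}IH]].
    by rewrite !big_nil setI0 cabv_set0.
  rewrite !big_cons setIUr cabv_setU ?IH//; try exact: borelI.
  rewrite setIACA setIid -subset0 => t [_ [Pit]].
  rewrite -bigcup_seq => -[j /= jr Pjt].
  have ij : i = j by apply: tP => //; exists t.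
  by rewrite -ij (negbTE ir) in jr.
rewrite -h ?index_enum_uniq//.
rewrite [X in A `&` X](_ : _ = setT) ?setIT// -PT -bigcup_seq.
by apply: eq_bigcupl; split => i //= _; rewrite mem_index_enum.
Qed.

(** The supremum defining the variation ranges over partitions into nonempty pieces indexed by
    ordinals. Empty atoms contribute nothing to the sum, so they are dropped and the others
    enumerated. *)
Lemma le_variation_norm mu (I : finType) (P : I -> set T) :
  (forall i, borel (P i)) -> trivIset setT P -> \bigcup_i P i = setT ->
  \sum_i rnorm (mu (P i)) <= variation_norm mu.
Proof.
move=> bP tP PT; have [_ _ vfin] := cabv_is_cabv mu.
pose A := [pred i | `[< P i !=set0 >]].
have -> : \sum_i rnorm (mu (P i)) = \sum_(j < #|A|) rnorm (mu (P (enum_val j))).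
  rewrite -(big_enum_val (A := A) (fun i => rnorm (mu (P i))))/=.
  rewrite [RHS]big_mkcond.
  apply: eq_bigr => i _; rewrite inE; case: asboolP => //.
  move=> /set0P/negP/negPn/eqP->.
  by rewrite cabv_set0 rnorm0.
have le1 : ((\sum_(j < #|A|) rnorm (mu (P (enum_val j))))%:E <=
    Defs.variation mu setT)%E.
  apply: ereal_sup_ubound; exists #|A|, (fun j => P (enum_val j)); split => //.
  split.
  - rewrite -subTset -PT => t [i _ Pit].
    have iA : i \in A by rewrite inE; exists t.
    by exists (enum_rank_in iA i) => //; rewrite enum_rankK_in.
  - by move=> i j _ _ ij; apply: enum_val_inj; apply: tP.
  - by move=> j _; have := enum_valP j; rewrite inE.
(* [fine] is faithful only on finite values: the variation is below +oo by [is_cabv], and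
   nonnegative by [le1]. *)
rewrite /variation_norm -lee_fin fineK//.
rewrite ge0_fin_numE// (le_trans _ le1)// lee_fin sumr_ge0// => j _.
exact: rnorm_ge0.
Qed.

Lemma variation_norm_ge0 mu : 0 <= variation_norm mu.
Proof.
apply: le_trans (@le_variation_norm mu unit (fun=> setT) _ _ _) => //.
- by rewrite sumr_ge0// => i _; exact: rnorm_ge0.
- by move=> [] [].
- by rewrite -subTset => t _; exists tt.
Qed.

End cabv_theory.

(** * Simple integrals *)

Section scalar_complete.
Variable R : realType.

Lemma real_cauchy_cvg (u : nat -> R) :
  (forall e : R, 0 < e -> exists N, forall m n, (N <= m)%N -> (N <= n)%N ->
    `|u m - u n| <= e) ->
  exists l, forall e, 0 < e -> \forall n \near \oo, `|l - u n| <= e.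
Proof.
move=> hu; have /cauchy_cvgP uc : cauchy (u @ \oo).
  apply: cauchy_exP => e e0.
  have [N hN] := hu _ (divr_gt0 e0 (ltr0n _ 2)).
  exists (u N); exists N => // n /= Nn.
  rewrite /ball/= (le_lt_trans (hN N n (leqnn _) Nn))//.
  by rewrite ltr_pdivrMr// ltr_pMr// ltr1n.
by exists (lim (u @ \oo)) => e e0; move/cvgrPdist_le : uc; exact.
Qed.

(** In the complex case each coordinate is dominated by the modulus, hence Cauchy. Conversely,
    coordinate errors at most e / 2 give a modulus at most e, since (e/2)^2 + (e/2)^2 <= (e/2 +
    e/2)^2. *)
Lemma scalar_cauchy_cvg (k : scalar_kind) (u : nat -> scalars R k) :
  (forall e : R, 0 < e -> exists N, forall m n, (N <= m)%N -> (N <= n)%N ->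
    rnorm (u m - u n) <= e) ->
  exists l, forall e, 0 < e -> \forall n \near \oo, rnorm (l - u n) <= e.
Proof.
case: k u => /= u hu; first exact: real_cauchy_cvg hu.
have sqrt_ge (a b : R) : `|a| <= Num.sqrt (a ^+ 2 + b ^+ 2).
  by rewrite -sqrtr_sqr ler_wsqrtr// lerDl sqr_ge0.
have rnormE (z : R[i]) :
    Normc.normc z = Num.sqrt (complex.Re z ^+ 2 + complex.Im z ^+ 2).
  by case: z.
have [|a ha] := @real_cauchy_cvg (fun n => complex.Re (u n)).
  move=> e /hu[N hN]; exists N => m n Nm Nn; apply: le_trans (hN m n Nm Nn).
  by rewrite rnormE raddfB/= sqrt_ge.
have [|b hb] := @real_cauchy_cvg (fun n => complex.Im (u n)).
  move=> e /hu[N hN]; exists N => m n Nm Nn; apply: le_trans (hN m n Nm Nn).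
  by rewrite rnormE [X in Num.sqrt X]addrC !raddfB/= sqrt_ge.
exists (a +i* b)%C => e e0; near=> n.
rewrite rnormE !raddfB/=.
have an : `|a - complex.Re (u n)| <= e / 2.
  by near: n; apply: ha; rewrite divr_gt0.
have bn : `|b - complex.Im (u n)| <= e / 2.
  by near: n; apply: hb; rewrite divr_gt0.
rewrite -[leRHS]ger0_norm ?(ltW e0)// -sqrtr_sqr ler_wsqrtr//.
rewrite -(real_normK (num_real (a - _))) -(real_normK (num_real (b - _))).
move: an bn; set x := `|a - _|; set y := `|b - _| => an bn.
have x0 : 0 <= x by exact: normr_ge0.
have y0 : 0 <= y by exact: normr_ge0.
have e20 : 0 <= e / 2 by rewrite divr_ge0// ltW.
rewrite (splitr e) sqrrD lerD//; last by rewrite lerXn2r ?nnegrE.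
rewrite (@le_trans _ _ ((e / 2) ^+ 2))//; first by rewrite lerXn2r ?nnegrE.
by rewrite lerDl mulrn_wge0// mulr_ge0.
Unshelve. all: end_near. Qed.

End scalar_complete.

Section simple_integrals.
Variables (R : realType) (k : scalar_kind).
Variables (T : metricType R) (X : completeNormedModType (scalars R k)).
Local Notation K := (scalars R k).
Variable dot : {dot X for @conj_scalar R k}.
Hypothesis dotE : norm_of_dot dot.
Implicit Types (mu : cabv T X) (s : simple_rep T X) (f : T -> X).

Lemma simple_fun_cat s1 s2 t :
  simple_fun (s1 ++ s2) t = simple_fun s1 t + simple_fun s2 t.
Proof. by rewrite /simple_fun big_cat. Qed.

Lemma simple_integral_cat mu s1 s2 : simple_integral dot mu (s1 ++ s2) =
  simple_integral dot mu s1 + simple_integral dot mu s2.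
Proof. by rewrite /simple_integral big_cat. Qed.

Definition simple_opp s : simple_rep T X := [seq (p.1, - p.2) | p <- s].

Lemma simple_fun_opp s t : simple_fun (simple_opp s) t = - simple_fun s t.
Proof.
by rewrite /simple_fun big_map -sumrN; apply: eq_bigr => p _; rewrite scalerN.
Qed.

Lemma simple_integral_opp mu s :
  simple_integral dot mu (simple_opp s) = - simple_integral dot mu s.
Proof.
by rewrite /simple_integral big_map -sumrN; apply: eq_bigr => p _;
  rewrite linearNl.
Qed.

Lemma simple_borel_cat s1 s2 :
  simple_borel s1 -> simple_borel s2 -> simple_borel (s1 ++ s2).
Proof. by move=> b1 b2 p; rewrite mem_cat => /orP[/b1|/b2]. Qed.

Lemma simple_borel_opp s : simple_borel s -> simple_borel (simple_opp s).
Proof. by move=> bs _ /mapP[p /bs bp ->]. Qed.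

(* Each new set of the list cuts every atom in two, hence the index I * bool. *)
Lemma simple_partition s : simple_borel s ->
  exists (I : finType) (P : I -> set T) (y : I -> X),
  [/\ forall i, borel (P i), trivIset setT P, \bigcup_i P i = setT,
      forall i t, P i t -> simple_fun s t = y i
    & forall mu, simple_integral dot mu s = \sum_i dot (y i) (mu (P i))].
Proof.
elim: s => [_|[A x] s IH bs].
  exists unit, (fun=> setT), (fun=> 0); split => //.
  - by move=> [] [].
  - by rewrite -subTset => t _; exists tt.
  - by move=> i t _; rewrite /simple_fun big_nil.
  - by move=> mu; rewrite /simple_integral big_nil big1// => i _;
      rewrite linear0l.
have bA : borel A by apply: (bs (A, x)); rewrite mem_head.
have [|I [P [y [bP tP PT ys Is]]]] := IH.
  by move=> p ps; apply: bs; rewrite inE ps orbT.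
exists (I * bool)%type, (fun i => if i.2 then P i.1 `&` A else P i.1 `\` A),
  (fun i => if i.2 then x + y i.1 else y i.1); split.
- by move=> [i []] /=; [exact: borelI|exact: borelD].
- move=> [i b] [j c] _ _ [t []] /= Pi Pj.
  have ij : i = j.
    by apply: tP => //; exists t; split; [case: b Pi => -[]|case: c Pj => -[]].
  by rewrite ij; case: b c Pi Pj => [] [] // [_ At] [_].
- rewrite -subTset => t _; have [i _ Pit] : (\bigcup_i P i) t by rewrite PT.
  by have [At|At] := pselect (A t); [exists (i, true)|exists (i, false)].
- move=> [i []] t /= [Pit At]; rewrite /simple_fun big_cons /=
    -/(simple_fun s t).
    by rewrite (ys i)// indicE mem_set// scale1r.
  by rewrite (ys i)// indicE memNset// scale0r add0r.
- move=> mu; rewrite /simple_integral big_cons /= -/(simple_integral dot mu s).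
  (* The term of (A, x) is spread over the old atoms; both sides are then compared atom by atom,
     where the two halves of [P i] recombine by additivity. *)
  rewrite Is (cabv_partition mu bA bP tP PT) raddf_sum -big_split /=.
  rewrite -(pair_bigA _ (fun i b => dot (if b then x + y i else y i)
    (mu (if b then P i `&` A else P i `\` A))))/=.
  apply: eq_bigr => i _; rewrite big_bool /= linearDl /= -addrA; congr (_ + _).
    by rewrite setIC.
  rewrite -linearDr /= -cabv_setU ?setUIDK//; [exact: borelI|exact: borelD|].
  by rewrite setDE setIACA setICr setI0.
Qed.

Lemma ler_simple_integral mu s c : simple_borel s -> 0 <= c ->
  (forall t, rnorm (simple_fun s t) <= c) ->
  rnorm (simple_integral dot mu s) <= c * variation_norm mu.
Proof.
move=> /simple_partition[I [P [y [bP tP PT ys ->]]]] c0 sc.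
apply: le_trans (ler_rnorm_sum _ _ _) _.
apply: le_trans (ler_wpM2l c0 (le_variation_norm mu bP tP PT)).
rewrite mulr_sumr; apply: ler_sum => i _.
(* The value [y i] is bounded by [c] only if it is attained; on an empty atom it is arbitrary, but
   the measure vanishes there. *)
have [->|/set0P[t Pit]] := eqVneq (P i) set0.
  by rewrite cabv_set0 linear0 !rnorm0 mulr0.
apply: le_trans (Cauchy_Schwarz dotE _ _) _.
by rewrite ler_wpM2r ?rnorm_ge0// -(ys _ _ Pit).
Qed.

End simple_integrals.

(** * Approximation of Lipschitz functions by simple functions *)

Section metric_space.
Variables (R : realType) (T : metricType R).

Lemma open_lipschitz_gt (d : T -> R) (L a : R) :
  (forall s t, d s - d t <= L * mdist s t) -> open [set t | a < d t].
Proof.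
move=> dL; rewrite openE => t /= at_; apply/nbhs_ballP.
(* [L] may be zero or negative, so it is replaced by a positive constant before dividing. *)
have L0 : 0 < `|L| + 1 by rewrite ltr_wpDl.
exists ((d t - a) / (`|L| + 1)); first by rewrite /= divr_gt0// subr_gt0.
move=> s; rewrite ballEmdist/= ltr_pdivlMr// => st.
have Lm : L * mdist t s <= `|L| * mdist t s.
  by rewrite ler_wpM2r ?mdist_ge0 ?ler_norm.
have := dL t s; have := mdist_ge0 t s; lra.
Qed.

(** If no finite net existed, the sets of points at distance at least [e] from a finite list would
    generate a proper filter. A cluster point [p] of it contradicts the member given by the list
    reduced to [p]. *)
Lemma compact_ball_cover (e : R) : compact [set: T] -> 0 < e ->
  exists r : seq T, forall t, exists2 x, x \in r & mdist x t < e.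
Proof.
move=> cT e0; apply: contrapT => /forallNP noCover.
pose F := filter_from (@setT (seq T))
  (fun r => [set t | forall x, x \in r -> e <= mdist x t]).
have F_filter : ProperFilter F.
  apply: filter_from_proper.
    apply: filter_from_filter; first by exists [::].
    move=> r1 r2 _ _; exists (r1 ++ r2) => // t h; split => x xr; apply: h.
      by rewrite mem_cat xr.
    by rewrite mem_cat xr orbT.
  move=> r _; have /existsNP[t ht] := noCover r; exists t => x xr.
  by rewrite leNgt; apply/negP => xt; apply: ht; exists x.
have [p [_ /(_ [set t | e <= mdist p t] (ball p e))[||t []]]] :=
  cT F F_filter filterT.
- by exists [:: p] => // t /(_ p); rewrite mem_head; exact.
- exact: nbhsx_ballx.
- by rewrite ballEmdist /= leNgt => /negP.
Qed.

End metric_space.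

Section approximation.
Variables (R : realType) (k : scalar_kind).
Variables (T : metricType R) (X : completeNormedModType (scalars R k)).
Local Notation K := (scalars R k).
Implicit Types (mu : cabv T X) (s : simple_rep T X) (f : T -> X).

Definition approximates (s : nat -> simple_rep T X) f :=
  (forall n, simple_borel (s n)) /\
  forall e : R, 0 < e ->
    \forall n \near \oo, forall t, rnorm (f t - simple_fun (s n) t) <= e.

Lemma uniform_cvg_rdistP (s : nat -> simple_rep T X) f :
  {uniform, (fun n => simple_fun (s n)) @ \oo --> f} <->
  forall e : R, 0 < e ->
    \forall n \near \oo, forall t, rnorm (f t - simple_fun (s n) t) <= e.
Proof.
split=> [sf e e0|sf P].
  have e0' : 0 < to_scalar k e by rewrite ltr0_to_scalar.
  have /sf : nbhs (f : {uniform` setT -> X})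
      [set h | forall t, setT t -> ball (f t) (to_scalar k e) (h t)].
    apply/uniform_nbhs; exists [set xy | ball xy.1 (to_scalar k e) xy.2].
    by split => //; exact: (entourage_ball _ (PosNum e0')).
  move=> [N _ hN]; exists N => // n /hN /= fn t; have := fn t Logic.I.
  by rewrite -ball_normE /= normr_rnorm => /ltW; rewrite le_to_scalar.
move=> /uniform_nbhs[E [+ EP]]; rewrite -entourage_ballE => -[e /= e0 eE].
have re0 : 0 < re_scalar e by rewrite -(ltr0_to_scalar k) re_scalarK// ltW.
(* Balls are defined by a strict inequality and the hypothesis is not strict, hence half the
   radius. *)
have := sf _ (divr_gt0 re0 (ltr0n _ 2)); apply: filterS => n /= fn.
apply: EP => t _; apply: eE => /=; rewrite -ball_normE /= normr_rnorm.
rewrite -(re_scalarK (ltW e0)) lt_neqAle le_to_scalar.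
have lt_e : rnorm (f t - simple_fun (s n) t) < re_scalar e.
  by rewrite (le_lt_trans (fn t))// ltr_pdivrMr// ltr_pMr// ltr1n.
rewrite (ltW lt_e) andbT; apply: contra_ltN lt_e => /eqP ee.
by rewrite -[leLHS](to_scalarK k) -ee to_scalarK.
Qed.

(* The balls are disjointified along the list; they are written as superlevel
   sets so that [open_lipschitz_gt] applies to them. *)
Fixpoint net_rep f (e : R) (r : seq T) : simple_rep T X :=
  if r is x :: r' then
    ([set t | - e < - mdist x t], f x) ::
    [seq (p.1 `\` [set t | - e < - mdist x t], p.2) | p <- net_rep f e r']
  else [::].

Lemma net_rep_borel f e r : simple_borel (net_rep f e r).
Proof.
have bB x : borel [set t : T | - e < - mdist x t].
  apply: open_borel; apply: (@open_lipschitz_gt _ _ _ 1) => s t.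
  by rewrite mul1r opprK addrC lerBlDr addrC metric_triangle.
elim: r => [//|x r IH] p; rewrite inE => /orP[/eqP->|/mapP[q /IH bq ->]].
  exact: bB.
exact: (borelD bq (bB x)).
Qed.

(** The centre is the first one of the list whose ball contains [t]: later sets have lost that ball,
    and removing the earlier balls does not affect [t]. *)
Lemma net_repE f e r t : (exists2 x, x \in r & mdist x t < e) ->
  exists2 x, mdist x t < e & simple_fun (net_rep f e r) t = f x.
Proof.
elim: r => [|x r IH] /=; first by case.
move=> [y yr yt]; rewrite /simple_fun big_cons big_map /=.
have [xt|xt] := ltP (mdist x t) e.
  exists x => //; rewrite indicE mem_set/= ?ltrN2// scale1r.
  rewrite big1 ?addr0// => p _.
  by rewrite indicE memNset ?scale0r//= ltrN2 => -[].
have [|z zt fz] := IH.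
  exists y => //; move: yr; rewrite inE => /orP[/eqP yx|//].
  by move: yt; rewrite yx ltNge xt.
exists z => //; rewrite -fz indicE memNset/= ?scale0r ?add0r; last first.
  by rewrite ltrN2 ltNge xt.
apply: eq_bigr => p _; rewrite !indicE; congr ((_ : bool)%:R *: _).
apply/idP/idP; rewrite !inE; first by case.
by move=> pt; split => //=; rewrite ltrN2 ltNge xt.
Qed.

Lemma lipschitz_approximation f : compact [set: T] -> lipschitz_fun f ->
  exists s : nat -> simple_rep T X, approximates s f.
Proof.
move=> cT [L [L0 fL]].
have h (n : nat) : exists r : seq T,
    forall t, exists2 x, x \in r & mdist x t < n.+1%:R^-1 :> R.
  by apply: compact_ball_cover; rewrite // invr_gt0 ltr0n.
have [r hr] := choice h.
exists (fun n => net_rep f n.+1%:R^-1 (r n)); split=> [n|e e0].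
  exact: net_rep_borel.
have : \forall n \near \oo, L * n.+1%:R^-1 <= e.
  have /cvgrPdist_le/(_ _ e0) : L * n.+1%:R^-1 @[n --> \oo] --> (0 : R).
    rewrite -(mulr0 L); apply: cvgMr; exact: cvg_harmonic.
  by apply: filterS => n; rewrite sub0r normrN ger0_norm// mulr_ge0.
move=> [N _ hN]; exists N => // n /hN /= Ln t.
have [x xt ->] := net_repE f (hr n t).
by rewrite rdistC (le_trans (fL _ _))// (le_trans _ Ln)// ler_wpM2l// ltW.
Qed.

Lemma lipschitz_bounded f : compact [set: T] -> lipschitz_fun f ->
  exists M, forall t, rnorm (f t) <= M.
Proof.
move=> cT [L [L0 fL]]; have [r hr] := compact_ball_cover cT ltr01.
(* The sum over the net stands in for a maximum; [L] bounds the variation of [f] within a ball of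
   radius 1. *)
exists (L + \sum_(x <- r) rnorm (f x)) => t; have [x xr xt] := hr t.
rewrite -(subrK (f x) (f t)) (le_trans (ler_rnormD _ _))// lerD//.
  by rewrite rdistC (le_trans (fL _ _))// -[leRHS]mulr1 ler_wpM2l// ltW.
by rewrite (big_rem x xr)/= lerDl sumr_ge0// => y _; exact: rnorm_ge0.
Qed.

End approximation.

(** * The Monge-Kantorovich seminorm *)

Section MK_seminorm.
Variables (R : realType) (k : scalar_kind).
Variables (T : metricType R) (X : completeNormedModType (scalars R k)).
Local Notation K := (scalars R k).
Variable dot : {dot X for @conj_scalar R k}.
Hypotheses (compT : compact [set: T]) (dotE : norm_of_dot dot).
Implicit Types (mu nu : cabv T X) (f : T -> X) (s : nat -> simple_rep T X).

(** With [s1] = [s2] this is the Cauchy property that makes the integral exist; with two sequences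
    it is the independence of the choice. The difference is the integral of one simple function,
    that of [s1 m] minus [s2 n], which is uniformly small. *)
Lemma approximates_dist mu f s1 s2 e :
  approximates s1 f -> approximates s2 f -> 0 < e ->
  exists N, forall m n, (N <= m)%N -> (N <= n)%N ->
    rnorm (simple_integral dot mu (s1 m) - simple_integral dot mu (s2 n)) <= e.
Proof.
move=> [b1 h1] [b2 h2] e0; have V0 := variation_norm_ge0 mu.
(* The factor 2 accounts for the two approximation errors; adding 1 covers a measure of norm 0. *)
pose d := e / (2 * (variation_norm mu + 1)).
have d0 : 0 < d by rewrite divr_gt0// mulr_gt0// ltr_wpDl.
have [N1 _ hN1] := h1 _ d0; have [N2 _ hN2] := h2 _ d0.
exists (maxn N1 N2) => m n; rewrite !geq_max => /andP[m1 _] /andP[_ n2].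
rewrite -simple_integral_opp -simple_integral_cat.
apply: (@le_trans _ _ ((d + d) * variation_norm mu)).
  apply: ler_simple_integral => //.
  - by apply: simple_borel_cat; last exact: simple_borel_opp.
  - by rewrite addr_ge0// ltW.
  move=> t; rewrite simple_fun_cat simple_fun_opp.
  apply: le_trans (ler_rdistD (f t) _ _) _.
  by rewrite rdistC lerD//; [exact: hN1|exact: hN2].
apply: (@le_trans _ _ ((d + d) * (variation_norm mu + 1))).
  by rewrite ler_wpM2l ?addr_ge0 ?lerDl// ltW.
have dV : d * (2 * (variation_norm mu + 1)) = e.
  by rewrite divfK// gt_eqF// mulr_gt0// ltr_wpDl.
by rewrite -[leRHS]dV mulrCA mulr_natl mulr2n mulrDl.
Qed.

Lemma vintegral_cvg mu f s e : approximates s f -> 0 < e ->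
  \forall n \near \oo,
    rnorm (vintegral dot mu f - simple_integral dot mu (s n)) <= e.
Proof.
move=> sf e0; have [|l sl] := @scalar_cauchy_cvg R k
  (fun n => simple_integral dot mu (s n)).
  by move=> d d0; exact: (approximates_dist mu sf sf d0).
have : integral_value dot mu f (vintegral dot mu f).
  (* A value exists, so [xget] does not return its default 0. The value comes with some unknown
     sequence [s'], which is then compared with [s]. *)
  apply: xgetPex; exists l, s; have [bs us] := sf; split => //.
    exact/uniform_cvg_rdistP.
  exact/(@cvg_rdistP R k K^o).
move=> [s' [bs' /uniform_cvg_rdistP us' /(@cvg_rdistP R k K^o) s'l]].
have e20 : 0 < e / 2 by rewrite divr_gt0.
have [N1 hN1] := approximates_dist mu (conj bs' us') sf e20.
have [N2 _ hN2] := s'l _ e20.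
exists (maxn N1 N2) => // n /=; rewrite geq_max => /andP[n1 n2].
apply: le_trans (ler_rdistD (simple_integral dot mu (s' n)) _ _) _.
by rewrite (splitr e) lerD//; [exact: hN2|exact: hN1].
Qed.

Lemma vintegral_unique mu f s v : approximates s f ->
  (forall e, 0 < e ->
    \forall n \near \oo, rnorm (v - simple_integral dot mu (s n)) <= e) ->
  vintegral dot mu f = v.
Proof.
move=> sf sv; apply/subr0_eq/rnorm_eq0/eqP; rewrite eq_le rnorm_ge0 andbT.
apply/ler_addgt0Pr => e e0; rewrite add0r.
have e20 : 0 < e / 2 by rewrite divr_gt0.
have [N1 _ hN1] := vintegral_cvg mu sf e20; have [N2 _ hN2] := sv _ e20.
apply: le_trans (ler_rdistD (simple_integral dot mu (s (maxn N1 N2))) _ _) _.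
rewrite (splitr e) lerD//; first exact/hN1/leq_maxl.
by rewrite rdistC; exact/hN2/leq_maxr.
Qed.

(** Approximation of [f] does not involve the measure, so a single sequence serves all three
    integrals. *)
Lemma vintegralD mu nu f : lipschitz_fun f ->
  vintegral dot (mu + nu) f = vintegral dot mu f + vintegral dot nu f.
Proof.
move=> /(lipschitz_approximation compT)[s sf].
apply: (vintegral_unique sf) => e e0.
have e20 : 0 < e / 2 by rewrite divr_gt0.
have [N1 _ hN1] := vintegral_cvg mu sf e20.
have [N2 _ hN2] := vintegral_cvg nu sf e20.
exists (maxn N1 N2) => // n /=; rewrite geq_max => /andP[n1 n2].
have -> : simple_integral dot (mu + nu) (s n) =
    simple_integral dot mu (s n) + simple_integral dot nu (s n).
  by rewrite -big_split; apply: eq_bigr => p _; exact: (raddfD (dot p.2)).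
rewrite opprD addrACA (le_trans (ler_rnormD _ _))// (splitr e).
by rewrite lerD//; [exact: hN1|exact: hN2].
Qed.

Lemma vintegralZ a mu f : lipschitz_fun f ->
  vintegral dot (a *: mu) f = conj_scalar a * vintegral dot mu f.
Proof.
move=> /(lipschitz_approximation compT)[s sf].
apply: (vintegral_unique sf) => e e0.
have a0 : 0 < rnorm a + 1 by rewrite ltr_wpDl// rnorm_ge0.
have [N _ hN] := vintegral_cvg mu sf (divr_gt0 e0 a0).
exists N => // n /hN /=; rewrite ler_pdivlMr// => le_e.
have -> : simple_integral dot (a *: mu) (s n) =
    conj_scalar a * simple_integral dot mu (s n).
  rewrite mulr_sumr; apply: eq_bigr => p _.
  exact: (@linearr_subproof _ _ _ _ _ _ dot).
rewrite -mulrBr rnormM rnorm_conj_scalar mulrC (le_trans _ le_e)//.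
by rewrite ler_wpM2l ?rnorm_ge0// lerDl.
Qed.

Lemma ler_vintegral mu f c : lipschitz_fun f -> 0 <= c ->
  (forall t, rnorm (f t) <= c) ->
  rnorm (vintegral dot mu f) <= c * variation_norm mu.
Proof.
move=> /(lipschitz_approximation compT)[s sf] c0 fc.
apply/ler_addgt0Pr => e e0; have V0 := variation_norm_ge0 mu.
have V1 : 0 < variation_norm mu + 1 by rewrite ltr_wpDl.
have e20 : 0 < e / 2 by rewrite divr_gt0.
(* The approximants are bounded by [c + d] rather than by [c]; this [d] makes the excess cost at
   most e / 2. *)
pose d := e / 2 / (variation_norm mu + 1); have d0 : 0 < d by rewrite divr_gt0.
have [N1 _ hN1] := vintegral_cvg mu sf e20.
have [bs us] := sf; have [N2 _ hN2] := us _ d0.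
set n := maxn N1 N2.
have le_sn t : rnorm (simple_fun (s n) t) <= c + d.
  rewrite -(subrK (f t) (simple_fun (s n) t)) (le_trans (ler_rnormD _ _))//.
  by rewrite addrC lerD// rdistC; exact/hN2/leq_maxr.
have := ler_simple_integral dotE mu (bs n) (addr_ge0 c0 (ltW d0)) le_sn.
have := hN1 n (leq_maxl _ _).
set v := vintegral _ _ _; set I := simple_integral _ _ _ => vI Ic.
rewrite -(subrK I v) (le_trans (ler_rnormD _ _))//.
rewrite (splitr e) addrA addrC lerD// (le_trans Ic)// mulrDl lerD//.
by rewrite /d mulrAC ler_pdivrMr// ler_wpM2l ?lerDl// ltW.
Qed.

Lemma BL1P f a b : (exists t : T, True) -> 0 <= b -> a + b <= 1 ->
  (forall t, rnorm (f t) <= a) -> lipschitz_constant f b -> BL1 f.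
Proof.
move=> [t0 _] b0 ab fa fb; split; first by exists b.
apply: le_trans ab; apply: lerD.
  apply: ge_sup; first by exists (rnorm (f t0)), t0.
  by move=> _ [t _ <-].
by apply: ge_inf => //; exists 0 => c [].
Qed.

Lemma BL1_rnorm_le1 f : BL1 f -> forall t, rnorm (f t) <= 1.
Proof.
move=> [Lf f1] t; apply: le_trans f1.
apply: (@le_trans _ _ (sup_norm f)).
  (* Compactness enters here: [sup] bounds the values of the norm only once these are known to be
     bounded. *)
  apply: ub_le_sup; last by exists t.
  by have [M fM] := lipschitz_bounded compT Lf; exists M => _ [u _ <-].
rewrite lerDl; apply: lb_le_inf; first by have [c fc] := Lf; exists c.
by move=> c [].
Qed.

Lemma MK_values_le mu : ubound (MK_values dot mu) (variation_norm mu).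
Proof.
move=> _ [f Bf <-]; rewrite -[leRHS]mul1r; apply: ler_vintegral => //.
  by case: Bf.
exact: BL1_rnorm_le1.
Qed.

Hypothesis T_neq0 : exists t : T, True.

Lemma BL1_0 : BL1 (fun _ : T => 0 : X).
Proof.
apply: (@BL1P _ 0 0 T_neq0 (lexx 0)).
- by rewrite addr0 ler01.
- by move=> t; rewrite rnorm0.
- by split => // s t; rewrite subrr rnorm0 mul0r.
Qed.

Lemma has_sup_MK_values mu : has_sup (MK_values dot mu).
Proof.
split; last by exists (variation_norm mu); exact: MK_values_le.
by exists (rnorm (vintegral dot mu (fun=> 0))), (fun=> 0) => //; exact: BL1_0.
Qed.

Lemma vintegral_le_MK_norm mu f : BL1 f ->
  rnorm (vintegral dot mu f) <= MK_norm dot mu.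
Proof.
by move=> Bf; apply: ub_le_sup; [case: (has_sup_MK_values mu)|exists f].
Qed.

Lemma MK_norm_le mu M :
  (forall f, BL1 f -> rnorm (vintegral dot mu f) <= M) -> MK_norm dot mu <= M.
Proof.
move=> fM; apply: ge_sup; first by case: (has_sup_MK_values mu).
by move=> _ [f Bf <-]; exact: fM.
Qed.

Lemma MK_norm_ge0 mu : 0 <= MK_norm dot mu.
Proof. exact: le_trans (rnorm_ge0 _) (vintegral_le_MK_norm mu BL1_0). Qed.

Lemma ler_MK_normD mu nu :
  MK_norm dot (mu + nu) <= MK_norm dot mu + MK_norm dot nu.
Proof.
apply: MK_norm_le => f Bf; rewrite vintegralD; last by case: Bf.
by apply: le_trans (ler_rnormD _ _) _; apply: lerD; exact: vintegral_le_MK_norm.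
Qed.

(** Only one inequality needs the integral; the other is the same one for [a^-1] and [a *: mu]. *)
Lemma MK_normZ a mu : MK_norm dot (a *: mu) = rnorm a * MK_norm dot mu.
Proof.
have leZ b nu : MK_norm dot (b *: nu) <= rnorm b * MK_norm dot nu.
  apply: MK_norm_le => f Bf; rewrite vintegralZ; last by case: Bf.
  rewrite rnormM rnorm_conj_scalar ler_wpM2l ?rnorm_ge0//.
  exact: vintegral_le_MK_norm.
apply/eqP; rewrite eq_le leZ/=.
have [->|a0] := eqVneq a 0; first by rewrite rnorm0 mul0r MK_norm_ge0.
have a1 : rnorm a * rnorm a^-1 = 1.
  by rewrite -rnormM divff// -(to_scalar1 R k) rnorm_to_scalar normr1.
have := leZ a^-1 (a *: mu); rewrite scalerA mulVf// scale1r.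
by move=> /(ler_wpM2l (rnorm_ge0 a)); rewrite mulrA a1 mul1r.
Qed.

End MK_seminorm.

(** * Definiteness *)

(** The sum counts the naturals below [y], that is, it is the ceiling of [y]. This is the error
    estimate of the layer cake approximation. *)
Lemma count_lt_itv (R : realType) (N : nat) (y : R) : 0 <= y <= N%:R ->
  y <= \sum_(0 <= i < N) (i%:R < y)%R%:R <= y + 1.
Proof.
move=> /andP[y0 yN].
have le_N n : \sum_(0 <= i < n) (i%:R < y)%R%:R <= n%:R :> R.
  elim: n => [|n IH]; first by rewrite big_geq.
  by rewrite big_nat_recr//= -natr1 lerD//; case: (_%:R < y) => //=;
    rewrite ler01.
apply/andP; split.
  (* A partial count over n indices cannot exceed n, so the induction needs the truncated bound. *)
  suff h n : Order.min y n%:R <= \sum_(0 <= i < n) (i%:R < y)%R%:R.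
    by apply: le_trans (h N); rewrite le_min lexx.
  elim: n => [|n IH]; first by rewrite big_geq// ge_min lexx orbT.
  rewrite big_nat_recr//=; have [ny|yn] := ltP n%:R y.
    by rewrite ge_min -natr1 lerD ?orbT//; move: IH; rewrite min_r// ltW.
  by rewrite addr0 (le_trans _ IH)// le_min !ge_min lexx yn.
elim: {yN} N => [|n IH]; first by rewrite big_geq// addr_ge0.
rewrite big_nat_recr//=; have [ny|yn] := ltP n%:R y; last by rewrite addr0.
by rewrite lerD// (le_trans (le_N n))// ltW.
Qed.

Section MK_definite.
Variables (R : realType) (k : scalar_kind).
Variables (T : metricType R) (X : completeNormedModType (scalars R k)).
Local Notation K := (scalars R k).
Implicit Types (mu : cabv T X) (d : T -> R).

Lemma borel_lipschitz_gt d (a : R) :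
  (forall s t, d s - d t <= mdist s t) -> borel [set t | a < d t].
Proof.
move=> dL; apply: open_borel; apply: (@open_lipschitz_gt _ _ _ 1) => s t.
by rewrite mul1r.
Qed.

Lemma cabv_gt_right_continuous mu d (e : R) :
  (forall s t, d s - d t <= mdist s t) -> 0 < e ->
  exists2 r : R, 0 < r & forall a : R, 0 <= a < r ->
    rnorm (mu [set t | a < d t] - mu [set t | 0 < d t]) <= e.
Proof.
move=> dL e0; apply: contrapT => /forall2NP noR.
have h r : exists a, 0 < r -> [/\ 0 < a, a < r &
    e < rnorm (mu [set t | a < d t] - mu [set t | 0 < d t])].
  have [r0|r0] := ltP 0 r; last by exists 0.
  have [//|/existsNP[a /not_implyP[/andP[a0 ar] /negP]]] := noR r.
  rewrite -ltNge => ea; exists a => _; split => //.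
  (* The level 0 is never bad, the difference being zero there, so bad levels are positive. *)
  rewrite lt_neqAle a0 andbT; apply: contraTneq ea => <-.
  by rewrite subrr rnorm0 -leNgt ltW.
(* mu is not monotone, so a sequence of bad levels decreasing to 0 has to be
   selected before sigma-additivity on increasing unions can be used. *)
have [g hg] := choice h.
(* The minimum forces the levels both to decrease and to tend to 0. *)
pose u := fix u n := if n is n'.+1 then g (Order.min (u n') n.+1%:R^-1)
                     else g 1.
have u_gt0 n : 0 < u n.
  elim: n => [|n IH] /=; first by case: (hg 1).
  have [] // := hg (Order.min (u n) n.+2%:R^-1).
  by rewrite lt_min IH/= invr_gt0.
have minu n : 0 < Order.min (u n) n.+2%:R^-1 by rewrite lt_min u_gt0 invr_gt0/=.
have bad n : e < rnorm (mu [set t | u n < d t] - mu [set t | 0 < d t]).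
  by case: n => [|n] /=; [case: (hg 1)|case: (hg _ (minu n))].
have u_decr n : u n.+1 <= u n.
  by have [_ + _] := hg _ (minu n); rewrite lt_min => /andP[/ltW].
have u_small n : u n.+1 < n.+2%:R^-1.
  by have [_ + _] := hg _ (minu n); rewrite lt_min => /andP[].
have ndF : nondecreasing_seq (fun n => [set t | u n < d t]).
  apply/nondecreasing_seqP => n; apply/subsetPset => t /=.
  exact: le_lt_trans (u_decr n).
have bF n : borel [set t | u n < d t] by exact: borel_lipschitz_gt.
have UF : \bigcup_n [set t | u n < d t] = [set t | 0 < d t].
  apply/seteqP; split=> [t [n _ /=]|t /= dt]; first exact: lt_trans (u_gt0 n).
  have [n _ hn] : \forall n \near \oo, n.+1%:R^-1 <= d t.
    have /cvgrPdist_le/(_ _ dt) : n.+1%:R^-1 @[n --> \oo] --> (0 : R).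
      exact: cvg_harmonic.
    by apply: filterS => n; rewrite sub0r normrN ger0_norm.
  exists n.+1 => //=; apply: lt_le_trans (u_small n) _.
  exact: (hn n.+1 (leqnSn n)).
have := @cabv_nondecreasing_cvg _ _ _ _ mu _ bF ndF.
rewrite UF => /cvg_rdistP/(_ _ e0).
by move=> [N _ /(_ N (leqnn N))/=]; rewrite rdistC leNgt bad.
Qed.

Variable dot : {dot X for @conj_scalar R k}.
Hypotheses (compT : compact [set: T]) (dotE : norm_of_dot dot).

Definition ramp d (r : R) t : R := Order.min 1 (d t / r).

(** There are [N.+1] levels, so that the average makes sense for every [N]. They start at 0 and stay
    below [r], the range in which the measures of the superlevel sets are controlled. *)
Definition ramp_rep d (r c : R) (x : X) (N : nat) : simple_rep T X :=
  [seq ([set t | i%:R * r / N.+1%:R < d t], to_scalar k (c / N.+1%:R) *: x)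
  | i <- index_iota 0 N.+1].

Lemma ramp_dist d r s t : 0 < r -> (forall s t, d s - d t <= mdist s t) ->
  `|ramp d r s - ramp d r t| <= mdist s t / r.
Proof.
move=> r0 dL.
have h s' t' : ramp d r s' - ramp d r t' <= mdist s' t' / r.
  rewrite /ramp lerBlDr [X in _ <= _ + X]/Order.min; case: ifPn => _.
    by rewrite ge_min lerDr divr_ge0 ?mdist_ge0// ltW.
  by rewrite ge_min -mulrDl ler_pM2r ?invr_gt0// -lerBlDr dL orbT.
by rewrite ler_norml h andbT lerNl opprB metric_sym h.
Qed.

Lemma approximates_ramp d r c x : 0 < r -> 0 <= c -> (forall t, 0 <= d t) ->
  (forall s t, d s - d t <= mdist s t) ->
  approximates (ramp_rep d r c x) (fun t => to_scalar k (c * ramp d r t) *: x).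
Proof.
move=> r0 c0 d0 dL; split=> [N p /mapP[i _ ->]|e e0].
  exact: borel_lipschitz_gt.
have : \forall n \near \oo, c * rnorm x * n.+1%:R^-1 <= e.
  have /cvgrPdist_le/(_ _ e0) :
      c * rnorm x * n.+1%:R^-1 @[n --> \oo] --> (0 : R).
    by rewrite -(mulr0 (c * rnorm x)); apply: cvgMr; exact: cvg_harmonic.
  apply: filterS => n; rewrite sub0r normrN ger0_norm// mulr_ge0//.
  by rewrite mulr_ge0 ?rnorm_ge0.
move=> [N _ hN]; exists N => // n /hN /= le_e t; apply: le_trans le_e.
have n0 : 0 < n.+1%:R :> R by rewrite ltr0n.
have ramp01 : 0 <= n.+1%:R * ramp d r t <= n.+1%:R.
  rewrite mulr_ge0 ?ler0n ?le_min ?ler01 ?divr_ge0 ?(ltW r0)//=.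
  by rewrite -[leRHS]mulr1 ler_wpM2l ?ler0n// ge_min lexx.
have /andP[cnt1 cnt2] := count_lt_itv ramp01.
set S := \sum_(_ <= _ < _) _ in cnt1 cnt2.
have -> : simple_fun (ramp_rep d r c x n) t =
    to_scalar k (c * (S / n.+1%:R)) *: x.
  have -> : c * (S / n.+1%:R) = \sum_(0 <= i < n.+1)
      (i%:R < n.+1%:R * ramp d r t)%R%:R * (c / n.+1%:R).
    by rewrite -mulr_suml -/S mulrCA.
  rewrite /simple_fun big_map.
  have -> : to_scalar k (\sum_(0 <= i < n.+1)
      (i%:R < n.+1%:R * ramp d r t)%R%:R * (c / n.+1%:R)) =
    \sum_(0 <= i < n.+1) to_scalar k
      ((i%:R < n.+1%:R * ramp d r t)%R%:R * (c / n.+1%:R)).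
    by apply: (big_morph _ (@to_scalarD R k)); exact: to_scalar0.
  rewrite scaler_suml !big_nat; apply: eq_bigr => i /andP[_ iN] /=.
  rewrite scalerA [in RHS]to_scalarM indicE; congr ((_ * _) *: _).
  (* The cap 1 in [ramp] disappears because i < n + 1. *)
  have -> : (i%:R < n.+1%:R * ramp d r t) = (i%:R * r / n.+1%:R < d t).
    rewrite /ramp minr_pMr ?ler0n// mulr1 lt_min ltr_nat iN/=.
    by rewrite mulrA ltr_pdivlMr// ltr_pdivrMr// (mulrC (d t)).
  have -> : (t \in [set t | i%:R * r / n.+1%:R < d t]) =
    (i%:R * r / n.+1%:R < d t) by apply/idP/idP; rewrite inE.
  by case: (_ < _); rewrite ?to_scalar1 ?to_scalar0.
rewrite -scalerBl -to_scalarN -to_scalarD -mulrBr rnormZ rnorm_to_scalar.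
rewrite normrM (ger0_norm c0) mulrAC ler_wpM2l ?mulr_ge0 ?rnorm_ge0//.
rewrite ler_distl; apply/andP; split.
  by rewrite -[X in _ - X]mul1r -mulrBl ler_pdivrMr// mulrC lerBlDr.
rewrite -[X in _ + X]mul1r -mulrDl ler_pdivlMr// mulrC.
by rewrite (le_trans cnt1)// lerDl.
Qed.

Lemma ramp_integral mu d r c x e : 0 < r -> 0 <= c -> (forall t, 0 <= d t) ->
  (forall s t, d s - d t <= mdist s t) ->
  (forall a, 0 <= a < r ->
    rnorm (mu [set t | a < d t] - mu [set t | 0 < d t]) <= e) ->
  rnorm (vintegral dot mu (fun t => to_scalar k (c * ramp d r t) *: x) -
    to_scalar k c * dot x (mu [set t | 0 < d t])) <= c * (rnorm x * e).
Proof.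
move=> r0 c0 d0 dL re; set U := [set t | 0 < d t].
have e0 : 0 <= e by apply: le_trans (re 0 _); rewrite ?rnorm_ge0// lexx.
apply/ler_addgt0Pl => eta eta0.
have [N _ hN] := vintegral_cvg dotE mu
  (approximates_ramp x r0 c0 d0 dL) eta0.
apply: le_trans (ler_rdistD _ _ _) _; apply: lerD (hN N (leqnn N)) _.
(* The target is written as an average over the same levels, so that the hypothesis [re] applies
   term by term. *)
have -> : to_scalar k c * dot x (mu U) =
    \sum_(0 <= i < N.+1) to_scalar k (c / N.+1%:R) * dot x (mu U).
  rewrite -mulr_suml; congr (_ * _).
  rewrite -(big_morph _ (@to_scalarD R k) (@to_scalar0 R k)).
  by rewrite sumr_const_nat subn0 -[_ *+ N.+1]mulr_natr divfK.
rewrite /simple_integral big_map -sumrB (le_trans (ler_rnorm_sum _ _ _))//.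
have -> : c * (rnorm x * e) = \sum_(0 <= i < N.+1) c / N.+1%:R * (rnorm x * e).
  by rewrite sumr_const_nat subn0 -[_ *+ N.+1]mulr_natr mulrAC divfK.
rewrite !big_nat; apply: ler_sum => i /andP[_ iN] /=.
rewrite linearZl_LR /= -mulrBr rnormM rnorm_to_scalar.
rewrite ger0_norm ?divr_ge0// ler_wpM2l ?divr_ge0//.
rewrite -linearB /= (le_trans (Cauchy_Schwarz dotE _ _))//.
rewrite ler_wpM2l ?rnorm_ge0// re// mulr_ge0 ?mulr_ge0 ?(ltW r0)//=.
by rewrite ltr_pdivrMr// mulrC ltr_pM2l// ltr_nat.
Qed.

Hypothesis T_neq0 : exists t : T, True.

Lemma MK_norm0_gt mu d : MK_norm dot mu = 0 -> (forall t, 0 <= d t) ->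
  (forall s t, d s - d t <= mdist s t) -> mu [set t | 0 < d t] = 0.
Proof.
move=> mu0 d0 dL; set x := mu _; have x0 := rnorm_ge0 x.
suff xe e : 0 < e -> rnorm x ^+ 2 <= e.
  apply/rnorm_eq0/eqP; rewrite -sqrf_eq0 eq_le sqr_ge0 andbT.
  by apply/ler_addgt0Pl => e e0; rewrite addr0 xe.
move=> e0; have x1 : 0 < rnorm x + 1 by rewrite ltr_wpDl.
(* This tolerance leads to |x|^2 <= |x| e / (|x| + 1) <= e, also when x = 0. *)
have [r r0 re] := cabv_gt_right_continuous mu dL (divr_gt0 e0 x1).
have r1 : 0 < 1 + r^-1 by rewrite addr_gt0 ?invr_gt0.
(* Chosen so that the sup bound c |x| and the Lipschitz bound c |x| / r add up to at most 1. *)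
pose c := ((1 + r^-1) * (rnorm x + 1))^-1.
have c0 : 0 < c by rewrite invr_gt0 mulr_gt0.
pose f t := to_scalar k (c * ramp d r t) *: x.
have Bf : BL1 f.
  apply: (@BL1P _ _ _ _ _ (c * rnorm x) (c * rnorm x / r)) => //.
  - by rewrite divr_ge0 ?mulr_ge0// ltW.
  - have -> : c * rnorm x + c * rnorm x / r = c * ((1 + r^-1) * rnorm x).
      by rewrite mulrDl mul1r mulrDr (mulrC r^-1) mulrA.
    rewrite -[leRHS](mulVf (lt0r_neq0 (mulr_gt0 r1 x1))) -/c.
    by rewrite !ler_wpM2l ?lerDl// ltW.
  - move=> t; rewrite rnormZ rnorm_to_scalar normrM gtr0_norm// mulrAC.
    rewrite -[leRHS]mulr1 ler_wpM2l ?mulr_ge0 ?(ltW c0)//.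
    by rewrite ger0_norm ?ge_min ?lexx// le_min ler01 divr_ge0// ltW.
  - split => [|s t]; first by rewrite divr_ge0 ?mulr_ge0// ltW.
    rewrite -scalerBl -to_scalarN -to_scalarD -mulrBr rnormZ rnorm_to_scalar.
    rewrite normrM gtr0_norm// mulrAC -[leRHS]mulrA.
    rewrite ler_wpM2l ?mulr_ge0 ?(ltW c0)//.
    by rewrite mulrC ramp_dist.
have fmu : vintegral dot mu f = 0.
  apply: rnorm_eq0; apply/eqP; rewrite eq_le rnorm_ge0 andbT -mu0.
  exact: vintegral_le_MK_norm.
have := ramp_integral x r0 (ltW c0) d0 dL re; rewrite -/f fmu sub0r rnormN -/x.
(* The constant [c] depends on [r], hence on [e], but it cancels from both sides. *)
rewrite rnormM rnorm_to_scalar gtr0_norm// ler_pM2l// -dotE expr2 rnormM.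
have -> : @rnorm R k K `|x| = rnorm x by rewrite /rnorm normr_id.
move=> /le_trans; apply; rewrite mulrA ler_pdivrMr// mulrC.
by rewrite ler_wpM2l ?lerDl// ltW.
Qed.

Definition dist_to (A : set T) t : R := inf [set mdist t s | s in A].

Lemma dist_to_ge0 A t : A !=set0 -> 0 <= dist_to A t.
Proof.
move=> [a Aa]; apply: lb_le_inf; first by exists (mdist t a), a.
by move=> _ [s _ <-]; exact: mdist_ge0.
Qed.

Lemma dist_to_lipschitz A s t : A !=set0 ->
  dist_to A s - dist_to A t <= mdist s t.
Proof.
move=> [a Aa]; rewrite lerBlDr -lerBlDl.
apply: lb_le_inf; first by exists (mdist t a), a.
move=> _ [b Ab <-]; rewrite lerBlDl (le_trans _ (metric_triangle _ t _))//.
apply: ge_inf; last by exists b.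
by exists 0 => _ [u _ <-]; exact: mdist_ge0.
Qed.

Lemma open_dist_to U : open U -> ~` U !=set0 ->
  [set t | 0 < dist_to (~` U) t] = U.
Proof.
move=> oU U0; apply/seteqP; split => t /= => [dt|Ut].
  apply: contrapT => nUt; move: dt; rewrite ltNge => /negP; apply.
  rewrite -(mdistxx t); apply: ge_inf; last by exists t.
  by exists 0 => _ [u _ <-]; exact: mdist_ge0.
move: oU; rewrite openE => /(_ _ Ut)/nbhs_ballP[e /= e0].
rewrite ballEmdist => eU; apply: (lt_le_trans e0).
case: U0 => a Ua; apply: lb_le_inf; first by exists (mdist t a), a.
by move=> _ [u nUu <-]; rewrite leNgt; apply/negP => /eU.
Qed.

Lemma MK_norm0_open mu U : MK_norm dot mu = 0 -> open U -> mu U = 0.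
Proof.
move=> mu0 oU; have [U0|/set0P U0] := eqVneq (~` U) set0.
  (* There is no distance to an empty complement; the constant 1 takes its place. *)
  rewrite -(setCK U) U0 setC0; have := @MK_norm0_gt mu (fun=> 1) mu0.
  rewrite (_ : [set _ | _] = setT); last by rewrite -subTset => t _ /=.
  by apply => // s t; rewrite subrr mdist_ge0.
rewrite -(open_dist_to oU U0).
apply: MK_norm0_gt => // [t|s t]; first exact: dist_to_ge0.
exact: dist_to_lipschitz.
Qed.

Lemma MK_norm0_eq0 mu : MK_norm dot mu = 0 -> mu = 0.
Proof.
move=> mu0; apply/val_inj/funext => A /=.
rewrite -[RHS]/(0 : X); have [bA|nbA] := pselect (borel A); last first.
  by have [-> ] := cabv_is_cabv mu.
(* Being Borel is part of the Dynkin class because the additivity of [mu] is available on Borel sets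
   only. *)
suff : @borel T `<=` [set A | borel A /\ mu A = 0] by move=> /(_ A bA)[].
have muT : mu setT = 0 by apply: MK_norm0_open => //; exact: openT.
apply: lambda_system_subset => //.
- by move=> B C; exact: openI.
- apply/dynkin_lambda_system; split => //.
  + move=> B [bB B0]; split; first exact: borelC.
    by rewrite -setTD cabv_setD ?muT ?B0 ?subr0.
  + move=> F tF bF; have bFi i : borel (F i) by case: (bF i).
    split; first exact: sigma_algebra_bigcup.
    have := @cabv_sigma_additive _ _ _ _ mu _ bFi tF.
    rewrite (_ : (fun n => _) = fun=> 0).
      by move=> /(cvg_unique (@norm_hausdorff _ X)); apply; exact: cvg_cst.
    by apply/funext => n; rewrite big1// => i _; case: (bF i).
- by move=> U oU; split; [exact: open_borel|exact: MK_norm0_open].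
Qed.

End MK_definite.

(** The first clause ensures that [MK_norm] is a genuine supremum, since [sup] has a default value
    on sets that are empty or unbounded. *)
Theorem theorem5 (R : realType) (k : scalar_kind)
  (T : metricType R) (compT : compact [set: T])
  (T_ge2 : exists s t : T, s <> t)
  (X : completeNormedModType (scalars R k))
  (dot : {dot X for @conj_scalar R k}) (dotE : norm_of_dot dot)
  (X_neq0 : exists x : X, x <> 0) :
  [/\ forall mu : cabv T X, has_sup (MK_values dot mu),
      is_norm (MK_norm (T := T) dot)
    & forall mu : cabv T X, MK_norm dot mu <= variation_norm mu].
Proof.
have T_neq0 : exists t : T, True by have [t _] := T_ge2; exists t.
split=> [mu||mu].
- exact: has_sup_MK_values.
- split=> [mu|mu|a mu|mu nu].
  + exact: MK_norm_ge0.
  + exact: MK_norm0_eq0.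
  + exact: MK_normZ.
  + exact: ler_MK_normD.
- apply: ge_sup; last exact: MK_values_le.
  by case: (has_sup_MK_values compT dotE T_neq0 mu).
Qed.
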